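(* Let $V:\Omega\to[1,\infty)$ be measurable and let $S$ be a stochastic operator on $\mathcal M_V$. Assume: (i) (operator Lyapunov condition) there exist $0<\gamma_L<1$ and $K\ge0$ such that $\|S\mu\|_V\le\gamma_L\|\mu\|_V+K\|\mu\|$ for all $\mu\in\mathcal M_V$; (ii) (local coupling condition) there exist $0<\gamma_H<1$ and $A>0$ such that for every $\nu\in\mathcal N_V$ with $\|\nu\|_V\le A\|\nu\|$ one has $\|S\nu\|\le\gamma_H\|\nu\|$; (iii) $K/A<1-\gamma_L$. Then $S$ has a unique equilibrium $\mu^*\in\mathcal P_V$, and there exist $\gamma\in(0,1)$ and $C\in[1,\infty)$ such that $$\|S^n\nu\|_V\le C\gamma^n\|\nu\|_V\qquad\text{for all }\nu\in\mathcal N_V\text{ and }n\in\mathbb N .$$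
   Context: Let $(\Omega,\mathcal E)$ be a measurable space. $\mathcal M$ denotes the space of finite signed measures on $\Omega$, $\mathcal P\subset\mathcal M$ the set of probability measures, and $\mathcal N=\{\nu\in\mathcal M:\nu(\Omega)=0\}$. For $\mu\in\mathcal M$ with Hahn–Jordan decomposition $\mu=\mu_+-\mu_-$, $|\mu|=\mu_++\mu_-$ and $\|\mu\|=\int_\Omega d|\mu|$ is the total variation norm. For a measurable $V:\Omega\to[1,\infty)$, $\|\mu\|_V=\int_\Omega V\,d|\mu|$, $\mathcal M_V=\{\mu\in\mathcal M:\|\mu\|_V<\infty\}$, $\mathcal P_V=\mathcal P\cap\mathcal M_V$, $\mathcal N_V=\mathcal N\cap\mathcal M_V$. A stochastic operator is a linear map $S:\mathcal M\to\mathcal M$ with $S(\mathcal P)\subseteq\mathcal P$; it is a stochastic operator on $\mathcal M_V$ if moreover $S(\mathcal M_V)\subseteq\mathcal M_V$ and the restriction is bounded for $\|\cdot\|_V$. An equilibrium of $S$ is a $\mu\in\mathcal P$ with $S\mu=\mu$. *)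

(* Defs.v *)
From HB Require Import structures.
From mathcomp Require Import all_boot all_order all_algebra.
From mathcomp Require Import all_classical all_reals all_analysis.
Set Implicit Arguments. Unset Strict Implicit. Unset Printing Implicit Defensive.
Import Order.TTheory GRing.Theory Num.Theory.
Import numFieldNormedType.Exports.
Local Open Scope classical_set_scope.
Local Open Scope ring_scope.

(* Finite signed measures on a measurable space T are the charges
   {charge set T -> \bar R} of MathComp-Analysis (finite-valued,
   sigma-additive set functions).  Two charges are identified when they
   agree on measurable sets. *)

Section TV.
Context d (T : measurableType d) (R : realType).

Lemma hahn_exists (nu : {charge set T -> \bar R}) :
  exists PN : set T * set T, hahn_decomposition nu PN.1 PN.2.
Proof.
have [P [N h]] := Hahn_decomposition nu.
by exists (P, N).
Qed.

Definition hahn_of (nu : {charge set T -> \bar R}) :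
  {PN : set T * set T | hahn_decomposition nu PN.1 PN.2} :=
  cid (hahn_exists nu).

Definition tvar (nu : {charge set T -> \bar R}) :=
  charge_variation (projT2 (hahn_of nu)).

Definition tvnorm (nu : {charge set T -> \bar R}) : \bar R := tvar nu setT.

Definition Vnorm (V : T -> R) (nu : {charge set T -> \bar R}) : \bar R :=
  (\int[tvar nu]_x (V x)%:E)%E.

Definition in_MV (V : T -> R) (nu : {charge set T -> \bar R}) : Prop :=
  (Vnorm V nu < +oo)%E.

Definition in_N (nu : {charge set T -> \bar R}) : Prop := nu setT = 0%E.

Definition is_prob (mu : {charge set T -> \bar R}) : Prop :=
  (forall A, measurable A -> (0 <= mu A)%E) /\ mu setT = 1%E.

Definition linear_op
  (S : {charge set T -> \bar R} -> {charge set T -> \bar R}) : Prop :=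
  (forall mu nu A, measurable A -> S (cadd mu nu) A = (S mu A + S nu A)%E) /\
  (forall (r : R) mu A, measurable A -> S (cscale r mu) A = (r%:E * S mu A)%E).

Definition stochastic_op
  (S : {charge set T -> \bar R} -> {charge set T -> \bar R}) : Prop :=
  linear_op S /\ (forall mu, is_prob mu -> is_prob (S mu)).

Definition stochastic_op_V (V : T -> R)
  (S : {charge set T -> \bar R} -> {charge set T -> \bar R}) : Prop :=
  stochastic_op S /\
  (forall mu, in_MV V mu -> in_MV V (S mu)) /\
  (exists c : R, forall mu, in_MV V mu -> (Vnorm V (S mu) <= c%:E * Vnorm V mu)%E).

Definition equilibrium
  (S : {charge set T -> \bar R} -> {charge set T -> \bar R})
  (mu : {charge set T -> \bar R}) : Prop :=
  is_prob mu /\ (forall A, measurable A -> S mu A = mu A).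

End TV.

(* Main.v *)
Require Import Defs.
From HB Require Import structures.
From mathcomp Require Import all_boot all_order all_algebra.
From mathcomp Require Import all_classical all_reals all_analysis.
From mathcomp Require Import measurable_realfun lra.
Set Implicit Arguments.
Unset Strict Implicit.
Unset Printing Implicit Defensive.
Import Order.TTheory GRing.Theory Num.Theory.
Import numFieldNormedType.Exports.
Local Open Scope classical_set_scope.
Local Open Scope ring_scope.

(** For a small [b > 0] the operator contracts the norm of weight [1 + b * V],
    which is [tvnorm nu + b * Vnorm V nu], on charges of mass zero: when
    [Vnorm V nu <= A * tvnorm nu], the gain of the coupling condition on
    [tvnorm nu] absorbs the Lyapunov error [b * K * tvnorm nu]; otherwise that
    error is at most [b * (K / A) * Vnorm V nu] and the Lyapunov condition alone
    contracts, since [gammaL + K / A < 1]. The norms of weight [V] and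
    [1 + b * V] being equivalent, this gives the geometric decay. The orbit of a
    Dirac mass then has summable increments, and its limit, which exists because
    charges of finite V-norm form a complete space, is the equilibrium. *)

Section geometric_series.
Context {R : realType}.
Local Open Scope ereal_scope.

Lemma cvg_EFin_geometric (a z : R) : (0 < z < 1)%R ->
  (a * z ^+ n)%:E @[n --> \oo] --> 0.
Proof.
move=> /andP[z0 z1]; apply: cvg_EFin; first exact: nearW.
by apply: cvg_geometric; rewrite gtr0_norm.
Qed.

Lemma nneseries_le_geometric_lty (u : (\bar R)^nat) (a z : R) : (0 < z < 1)%R ->
  (forall n, 0 <= u n <= (a * z ^+ n)%:E) -> \sum_(0 <= k <oo) u k < +oo.
Proof.
move=> /andP[z0 z1] ua.
have u0 n : 0 <= u n by case/andP: (ua n).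
have a0 : (0 <= a)%R.
  by have /andP[] := ua 0%N; rewrite expr0 mulr1 -lee_fin; exact: le_trans.
apply: (@le_lt_trans _ _ (a / (1 - z))%:E); last exact: ltry.
apply: lime_le; first by apply: is_cvg_nneseries.
apply: nearW => n; apply: (@le_trans _ _ (\sum_(0 <= k < n) (a * z ^+ k)%:E)).
  by apply: lee_sum => k _; case/andP: (ua k).
by rewrite sumEFin lee_fin; apply: geometric_le_lim => //; rewrite gtr0_norm.
Qed.

End geometric_series.

Section charges.
Context d (T : measurableType d) (R : realType).
Local Open Scope ereal_scope.
Implicit Types (mu nu : {charge set T -> \bar R}).

Definition charge_eq mu nu : Prop := forall B, measurable B -> mu B = nu B.

Definition nonneg_charge nu : Prop := forall B, measurable B -> 0 <= nu B.

Definition csub mu nu : {charge set T -> \bar R} := cadd mu (cscale (-1) nu).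

Lemma csubE mu nu B : csub mu nu B = mu B - nu B.
Proof. by rewrite -[LHS]/(mu B + cscale (-1) nu B) cscaleN1. Qed.

Lemma csub_eq0 mu nu B : measurable B -> csub mu nu B = 0 -> mu B = nu B.
Proof.
move=> mB /eqP; rewrite csubE sube_eq ?fin_num_adde_defl ?fin_num_measure//.
by rewrite add0e => /eqP.
Qed.

Lemma in_N_csub_prob mu nu : is_prob mu -> is_prob nu -> in_N (csub mu nu).
Proof. by move=> [_ mu1] [_ nu1]; rewrite /in_N csubE mu1 nu1 subee. Qed.

Definition cdirac (a : T) : {charge set T -> \bar R} :=
  charge_of_finite_measure (\d_a : {finite_measure set T -> \bar R}).

Lemma is_prob_cdirac a : is_prob (cdirac a).
Proof. by split => [B mB|]; [exact: measure_ge0|exact: diracT]. Qed.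

Lemma charge_of_measure_lty (m : {measure set T -> \bar R}) :
  m setT < +oo ->
  exists nu : {charge set T -> \bar R}, nu = m :> (set T -> \bar R).
Proof.
move=> moo.
pose isc := isCharge.Build _ T R m (measure0 m) (lty_fin_num_fun moo)
  measure_semi_sigma_additive.
pose nu : {charge set T -> \bar R} := HB.pack (m : set T -> \bar R) isc.
by exists nu.
Qed.

HB.instance Definition _ nu := Measure.on (tvar nu).

Definition charge_pos nu : {finite_measure set T -> \bar R} :=
  jordan_pos (projT2 (hahn_of nu)).

Definition charge_neg nu : {finite_measure set T -> \bar R} :=
  jordan_neg (projT2 (hahn_of nu)).

Lemma charge_posBneg nu B : measurable B ->
  nu B = charge_pos nu B - charge_neg nu B.
Proof.
by move=> mB; rewrite (jordan_decomp (projT2 (hahn_of nu)) mB) /cadd/= cscaleN1.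
Qed.

Lemma tvarE nu B : tvar nu B = charge_pos nu B + charge_neg nu B.
Proof. by []. Qed.

Lemma tvnorm_ge0 nu : 0 <= tvnorm nu.
Proof. exact: (@measure_ge0 _ _ _ (tvar nu)). Qed.

Lemma tvnorm_fin_num nu : tvnorm nu \is a fin_num.
Proof. by rewrite /tvnorm tvarE fin_numD !fin_num_measure. Qed.

Lemma abse_le_tvar nu B : measurable B -> `|nu B| <= tvar nu B.
Proof. exact: abse_charge_variation. Qed.

Lemma tvar_le_additive nu (m : set T -> \bar R) : additive2 m ->
  (forall B, measurable B -> `|nu B| <= m B) ->
  forall B, measurable B -> tvar nu B <= m B.
Proof.
move=> addm num B mB; rewrite /tvar /charge_variation.
case: (hahn_of nu) => -[P N] /= nuPN.
have [[mP _] [mN _] PNT PN0] := nuPN.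
rewrite jordan_posE cjordan_posE jordan_negE cjordan_negE.
rewrite /crestr0 mem_set// /crestr.
have mBP : measurable (B `&` P) by exact: measurableI.
have mBN : measurable (B `&` N) by exact: measurableI.
have -> : m B = m (B `&` P) + m (B `&` N).
  rewrite -[in LHS](setIT B) -PNT setIUr; apply: addm => //.
  by rewrite setIACA PN0 setI0.
apply: leeD; first exact: le_trans (lee_abs _) (num _ mBP).
by apply: le_trans (num _ mBN); rewrite -abseN; exact: lee_abs.
Qed.

Definition setwise_cvg (mu : {charge set T -> \bar R}^nat)
    (l : {charge set T -> \bar R}) : Prop :=
  forall B, measurable B -> mu n B @[n --> \oo] --> l B.

Lemma charge_series_cvg (nu : {charge set T -> \bar R}^nat) :
  \sum_(0 <= k <oo) tvnorm (nu k) < +oo ->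
  exists l : {charge set T -> \bar R}, forall B, measurable B ->
    \sum_(0 <= k < n) nu k B @[n --> \oo] --> l B.
Proof.
move=> nuoo.
have [P PE] : exists P : {charge set T -> \bar R},
    P = mseries (charge_pos \o nu) 0 :> (set T -> \bar R).
  apply: charge_of_measure_lty; apply: le_lt_trans nuoo.
  by apply: lee_nneseries => // k _; rewrite /tvnorm tvarE leeDl.
have [Q QE] : exists Q : {charge set T -> \bar R},
    Q = mseries (charge_neg \o nu) 0 :> (set T -> \bar R).
  apply: charge_of_measure_lty; apply: le_lt_trans nuoo.
  by apply: lee_nneseries => // k _; rewrite /tvnorm tvarE leeDr.
exists (csub P Q) => B mB; rewrite csubE.
have -> : (fun n => \sum_(0 <= k < n) nu k B) =
    (fun n => \sum_(0 <= k < n) charge_pos (nu k) B) \-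
    (fun n => \sum_(0 <= k < n) charge_neg (nu k) B).
  apply/funext => n /=; rewrite -sumeN; last first.
    by move=> i j _ _; rewrite fin_num_adde_defl// fin_num_measure.
  by rewrite -big_split/=; apply: eq_bigr => k _; exact: charge_posBneg.
apply: cvgeB; first by rewrite fin_num_adde_defr// fin_num_measure.
- by rewrite PE; exact: is_cvg_nneseries.
- by rewrite QE; exact: is_cvg_nneseries.
Qed.

Lemma setwise_complete (mu : {charge set T -> \bar R}^nat) :
  \sum_(0 <= k <oo) tvnorm (csub (mu k.+1) (mu k)) < +oo ->
  exists l, setwise_cvg mu l.
Proof.
move=> /charge_series_cvg[l nul]; exists (cadd (mu 0%N) l) => B mB.
have -> : (fun n => mu n B) =
    cst (mu 0%N B) \+ (fun n => \sum_(0 <= k < n) csub (mu k.+1) (mu k) B).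
  apply/funext => n /=; under eq_bigr do rewrite csubE.
  rewrite telescope_sume//; last by move=> k _; rewrite fin_num_measure.
  by rewrite [RHS]addeC subeK// fin_num_measure.
apply: cvgeD; first by rewrite fin_num_adde_defr// fin_num_measure.
- exact: cvg_cst.
- exact: nul.
Qed.

Lemma abse_sub_setwise_lim (mu : {charge set T -> \bar R}^nat) l B :
  setwise_cvg mu l -> measurable B ->
  `|mu 0%N B - l B| <= \sum_(0 <= k <oo) tvar (csub (mu k.+1) (mu k)) B.
Proof.
move=> mul mB.
have abs_cvg : `|mu 0%N B - mu n B| @[n --> \oo] --> `|mu 0%N B - l B|.
  apply: cvg_abse; apply: cvgeB.
  - by rewrite fin_num_adde_defr// fin_num_measure.
  - exact: cvg_cst.
  - exact: mul.
apply: (cvge_to_le abs_cvg); apply: nearW => n.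
have fin_mu k : mu k B \is a fin_num by exact: fin_num_measure.
rewrite -abseN fin_num_oppeB// addeC -(@telescope_sume _ 0 n (mu ^~ B))//.
apply: le_trans (lee_abs_sum _ _ _) _.
apply: (@le_trans _ _ (\sum_(0 <= k < n) tvar (csub (mu k.+1) (mu k)) B)).
  by apply: lee_sum => k _; rewrite -csubE abse_le_tvar.
by apply: nneseries_lim_ge => k _ _; exact: measure_ge0.
Qed.

Lemma is_prob_setwise_cvg (mu : {charge set T -> \bar R}^nat) l :
  setwise_cvg mu l -> (forall n, is_prob (mu n)) -> is_prob l.
Proof.
move=> mul muP; split=> [B mB|].
  by apply: (cvge_to_ge (mul B mB)); apply: nearW => n; exact: (muP n).1.
apply: (cvg_unique _ (mul _ measurableT)) => //.
by apply: cvg_near_cst; apply: nearW => n; exact: (muP n).2.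
Qed.

End charges.

Section weighted_norm.
Context d (T : measurableType d) (R : realType).
Local Open Scope ereal_scope.
Implicit Types (mu nu : {charge set T -> \bar R}).

Section nonnegative_weight.
Variable V : T -> R.
Hypotheses (mV : measurable_fun [set: T] V) (V0 : forall x, (0 <= V x)%R).

Let mVE : measurable_fun [set: T] (EFin \o V).
Proof. exact/measurable_EFinP. Qed.

Let VE0 x : 0 <= (V x)%:E. Proof. by rewrite lee_fin. Qed.

Lemma Vnorm_ge0 nu : 0 <= Vnorm V nu.
Proof. exact: integral_ge0. Qed.

Lemma le_Vnorm (U : T -> R) (c : R) nu :
  measurable_fun [set: T] U ->
  (forall x, 0 <= U x <= c * V x)%R -> (0 <= c)%R ->
  Vnorm U nu <= c%:E * Vnorm V nu.
Proof.
move=> mU UcV c0; rewrite /Vnorm -ge0_integralZl_EFin//.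
apply: ge0_le_integral => //.
- by move=> x _; rewrite lee_fin; case/andP: (UcV x).
- exact/measurable_EFinP.
- by apply: measurable_funeM.
- by move=> x _; rewrite -EFinM lee_fin; case/andP: (UcV x).
Qed.

Lemma Vnorm_le_integral nu (m : {measure set T -> \bar R}) :
  (forall B, measurable B -> `|nu B| <= m B) ->
  Vnorm V nu <= \int[m]_x (V x)%:E.
Proof.
move=> num; apply: ge0_le_measure_integral => //.
by apply: tvar_le_additive num => A B mA mB AB; rewrite measureU.
Qed.

Lemma eq_Vnorm mu nu : charge_eq mu nu -> Vnorm V mu = Vnorm V nu.
Proof.
move=> munu; apply/eqP; rewrite eq_le !Vnorm_le_integral// => B mB.
  by rewrite -munu// abse_le_tvar.
by rewrite munu// abse_le_tvar.
Qed.

Lemma Vnorm_csub mu nu : Vnorm V (csub mu nu) <= Vnorm V mu + Vnorm V nu.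
Proof.
rewrite /Vnorm -ge0_integral_measure_add//; apply: Vnorm_le_integral => B mB.
rewrite csubE; apply: le_trans (lee_abs_sub _ _) _.
rewrite -[leRHS]/(measure_add (tvar mu) (tvar nu) B) measure_addE.
by apply: leeD; exact: abse_le_tvar.
Qed.

Lemma in_MV_csub mu nu : in_MV V mu -> in_MV V nu -> in_MV V (csub mu nu).
Proof.
move=> muV nuV; apply: le_lt_trans (Vnorm_csub _ _) _.
exact: lte_add_pinfty.
Qed.

Lemma Vnorm_csub_lim (mu : {charge set T -> \bar R}^nat) l :
  setwise_cvg mu l ->
  Vnorm V (csub (mu 0%N) l) <=
    \sum_(0 <= k <oo) Vnorm V (csub (mu k.+1) (mu k)).
Proof.
move=> mul; rewrite -ge0_integral_measure_series//.
apply: Vnorm_le_integral => B mB; rewrite csubE.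
exact: abse_sub_setwise_lim.
Qed.

Definition Vcvg (mu : {charge set T -> \bar R}^nat) l : Prop :=
  Vnorm V (csub (mu n) l) @[n --> \oo] --> 0.

Lemma Vcvg_in_MV (mu : {charge set T -> \bar R}^nat) l :
  Vcvg mu l -> (forall n, in_MV V (mu n)) -> in_MV V l.
Proof.
move=> /fine_cvgP[[n _ /(_ n (leqnn n)) finV] _] muV.
have lE : charge_eq l (csub (mu n) (csub (mu n) l)).
  move=> B mB; rewrite !csubE fin_num_oppeB ?fin_num_measure// addeA.
  by rewrite subee ?add0e ?fin_num_measure.
rewrite /in_MV (eq_Vnorm lE); apply: le_lt_trans (Vnorm_csub _ _) _.
by rewrite lte_add_pinfty//; [exact: muV|rewrite ltey_eq finV].
Qed.

Lemma in_MV_cdirac a : in_MV V (cdirac R a).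
Proof.
apply: (@le_lt_trans _ _ (\int[\d_a]_x (V x)%:E)).
  by apply: Vnorm_le_integral => B mB; rewrite gee0_abs.
by rewrite integral_dirac// diracT mul1e ltry.
Qed.

End nonnegative_weight.

Lemma tvnormE nu : tvnorm nu = Vnorm (cst 1%R) nu.
Proof. by rewrite /Vnorm/= integral_cst// mul1e. Qed.

Section weight_ge1.
Variable V : T -> R.
Hypotheses (mV : measurable_fun [set: T] V) (V1 : forall x, (1 <= V x)%R).

Let V0 x : (0 <= V x)%R. Proof. exact: le_trans ler01 (V1 x). Qed.

Lemma tvnorm_le_Vnorm nu : tvnorm nu <= Vnorm V nu.
Proof.
rewrite tvnormE -[leRHS]mul1e; apply: le_Vnorm => // x.
by rewrite ler01 mul1r V1.
Qed.

Lemma abse_le_Vnorm nu B : measurable B -> `|nu B| <= Vnorm V nu.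
Proof.
move=> mB; apply: le_trans (abse_le_tvar _ mB) _.
by apply: le_trans (tvnorm_le_Vnorm _); apply: le_measure; rewrite ?inE.
Qed.

Lemma Vnorm_csub_le0 mu nu : Vnorm V (csub mu nu) <= 0 -> charge_eq mu nu.
Proof.
move=> munu0 B mB; apply: csub_eq0 => //; apply/eqP.
by rewrite -abse_eq0 eq_le abse_ge0 andbT (le_trans (abse_le_Vnorm _ mB)).
Qed.

Lemma Vcvg_setwise_cvg (mu : {charge set T -> \bar R}^nat) l :
  Vcvg V mu l -> setwise_cvg mu l.
Proof.
move=> mul B mB; apply/sube_cvg0; first exact: fin_num_measure.
apply/cvg_abse0P; apply: squeeze_cvge (cvg_cst 0) mul.
by apply: nearW => n /=; rewrite abse_ge0 -csubE abse_le_Vnorm.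
Qed.

Lemma Vnorm_complete (mu : {charge set T -> \bar R}^nat) :
  \sum_(0 <= k <oo) Vnorm V (csub (mu k.+1) (mu k)) < +oo ->
  exists l, Vcvg V mu l.
Proof.
move=> muoo; have [|l mul] := @setwise_complete _ _ _ mu.
  apply: le_lt_trans muoo; apply: lee_nneseries => k *.
    exact: tvnorm_ge0.
  exact: tvnorm_le_Vnorm.
have tail_cvg0 := nneseries_tail_cvg muoo (fun k _ => Vnorm_ge0 V0 _).
exists l; apply: squeeze_cvge (cvg_cst 0) tail_cvg0.
apply: nearW => n /=; rewrite Vnorm_ge0//=.
rewrite -nneseries_addn; last by move=> k; exact: Vnorm_ge0.
apply: (Vnorm_csub_lim mV V0 (mu := fun k => mu (k + n)%N)) => B mB.
by move: (mul B mB); rewrite -(cvg_shiftn n).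
Qed.

End weight_ge1.
End weighted_norm.

Section stochastic_operator.
Context d (T : measurableType d) (R : realType).
Local Open Scope ereal_scope.
Variable S : {charge set T -> \bar R} -> {charge set T -> \bar R}.
Hypothesis stochS : stochastic_op S.
Implicit Types (mu nu : {charge set T -> \bar R}).

Let S_cadd mu nu B : measurable B -> S (cadd mu nu) B = S mu B + S nu B.
Proof. by case: stochS => -[+ _] _; exact. Qed.

Let S_cscale (r : R) nu B : measurable B -> S (cscale r nu) B = r%:E * S nu B.
Proof. by case: stochS => -[_ +] _; exact. Qed.

Let S_prob mu : is_prob mu -> is_prob (S mu).
Proof. by case: stochS => _; exact. Qed.

Lemma stochastic_op_csub mu nu B : measurable B ->
  S (csub mu nu) B = S mu B - S nu B.
Proof. by move=> mB; rewrite S_cadd// S_cscale// mulN1e. Qed.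

Let stochastic_op_gt0_mass mu : nonneg_charge mu -> 0 < mu setT ->
  nonneg_charge (S mu) /\ S mu setT = mu setT.
Proof.
move=> mu0.
have /EFin_fin_numP[m mE] := fin_num_measure mu _ (@measurableT _ T).
rewrite mE lte_fin => m0.
have mV0 : 0 < m^-1%:E by rewrite lte_fin invr_gt0.
have : is_prob (cscale m^-1 mu).
  split=> [B mB|]; first by rewrite mule_ge0 ?mu0// ltW.
  by rewrite -[LHS]/(m^-1%:E * mu setT) mE -EFinM mulVf// gt_eqF.
move=> /S_prob[Smu0]; rewrite S_cscale// => Smu1; split.
  by move=> B mB; rewrite -(pmule_rge0 _ mV0) -S_cscale// Smu0.
by rewrite -[LHS]mul1e -(@divff _ m) ?gt_eqF// EFinM -muleA Smu1 mule1.
Qed.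

(* A charge of mass zero cannot be normalized, so it is first perturbed by a
   small multiple of a Dirac mass. *)
Lemma stochastic_op_nonneg mu : nonneg_charge mu ->
  nonneg_charge (S mu) /\ S mu setT = mu setT.
Proof.
move=> mu0.
pose delta : {charge set T -> \bar R} := cdirac R (point : T).
have [delta0 delta1] := is_prob_cdirac R (point : T).
have [Sdelta0 Sdelta1] := S_prob (is_prob_cdirac R (point : T)).
pose nu t : {charge set T -> \bar R} := cadd mu (cscale t delta).
have nuE t B : nu t B = mu B + t%:E * delta B by [].
have Snu t : (0 < t)%R -> nonneg_charge (S (nu t)) /\ S (nu t) setT = nu t setT.
  move=> t0; apply: stochastic_op_gt0_mass.
  - by move=> B mB; rewrite nuE adde_ge0 ?mule_ge0 ?mu0 ?delta0 ?lee_fin// ltW.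
  - by rewrite nuE delta1 mule1 lte_paddl ?mu0.
split=> [B mB|]; last first.
  have [_] := Snu _ (@ltr01 R).
  rewrite /nu S_cadd// S_cscale// Sdelta1 -/(nu 1%R) nuE delta1 mule1.
  by move=> /(congr1 (fun x => x - 1)); rewrite !addeK.
have := Sdelta0 _ mB.
have /EFin_fin_numP[b bE] := fin_num_measure (S delta) _ mB.
have /EFin_fin_numP[a aE] := fin_num_measure (S mu) _ mB.
rewrite aE bE !lee_fin => b0; apply/ler_addgt0Pr => e e0.
have b1 : (0 < b + 1)%R by rewrite ltr_wpDl.
have /Snu[/(_ _ mB)] : (0 < e / (b + 1))%R by rewrite divr_gt0.
rewrite /nu S_cadd// S_cscale// aE bE -EFinM -EFinD lee_fin.
move=> /le_trans + _; apply.
by rewrite lerD2l mulrAC ler_pdivrMr// ler_pM2l// lerDl.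
Qed.

Lemma stochastic_op_eq mu nu : charge_eq mu nu -> charge_eq (S mu) (S nu).
Proof.
have le_S mu' nu' B : measurable B -> charge_eq mu' nu' -> S nu' B <= S mu' B.
  move=> mB eq'; rewrite -sube_ge0 ?fin_num_measure// -stochastic_op_csub//.
  apply: (stochastic_op_nonneg _).1 => // C mC.
  by rewrite csubE eq'// subee// fin_num_measure.
move=> munu B mB; apply/eqP; rewrite eq_le !le_S// => C mC.
by rewrite munu.
Qed.

Lemma stochastic_op_posBneg nu B : measurable B ->
  S nu B = S (charge_of_finite_measure (charge_pos nu)) B -
           S (charge_of_finite_measure (charge_neg nu)) B.
Proof.
move=> mB; rewrite -stochastic_op_csub//; apply: stochastic_op_eq => // C mC.
by rewrite csubE charge_posBneg.
Qed.

Lemma stochastic_op_mass nu : S nu setT = nu setT.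
Proof.
have mass (m : {finite_measure set T -> \bar R}) :
    S (charge_of_finite_measure m) setT = m setT.
  by apply: (stochastic_op_nonneg _).2 => B mB; exact: measure_ge0.
by rewrite stochastic_op_posBneg// !mass [RHS]charge_posBneg.
Qed.

Lemma tvnorm_stochastic_op nu : tvnorm (S nu) <= tvnorm nu.
Proof.
pose p := S (charge_of_finite_measure (charge_pos nu)).
pose q := S (charge_of_finite_measure (charge_neg nu)).
have [p0 pT] : nonneg_charge p /\ p setT = charge_pos nu setT.
  by apply: stochastic_op_nonneg => B mB; exact: measure_ge0.
have [q0 qT] : nonneg_charge q /\ q setT = charge_neg nu setT.
  by apply: stochastic_op_nonneg => B mB; exact: measure_ge0.
rewrite {2}/tvnorm tvarE -pT -qT -[leRHS]/(cadd p q setT).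
apply: (tvar_le_additive (@chargeU _ _ _ (cadd p q))) => // B mB.
rewrite stochastic_op_posBneg//; apply: le_trans (lee_abs_sub _ _) _.
by rewrite !gee0_abs ?p0 ?q0.
Qed.

End stochastic_operator.

Lemma stochastic_op_iter d (T : measurableType d) (R : realType)
    (S : {charge set T -> \bar R} -> {charge set T -> \bar R}) n :
  stochastic_op S -> stochastic_op (iter n S).
Proof.
move=> stochS; have [[S_cadd S_cscale] S_prob] := stochS.
elim: n => [|n [[IHcadd IHcscale] IHprob]]; first by [].
split; last by move=> mu /IHprob/S_prob.
split=> [mu nu B mB|r mu B mB] /=.
- by rewrite -S_cadd//; apply: stochastic_op_eq => // C; exact: IHcadd.
- by rewrite -S_cscale//; apply: stochastic_op_eq => // C; exact: IHcscale.
Qed.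

Section ergodicity_conditions.
Context d (T : measurableType d) (R : realType).
Local Open Scope ereal_scope.
Variable V : T -> R.
Variable S : {charge set T -> \bar R} -> {charge set T -> \bar R}.

Definition lyapunov_condition (gammaL K : R) : Prop := forall mu, in_MV V mu ->
  Vnorm V (S mu) <= gammaL%:E * Vnorm V mu + K%:E * tvnorm mu.

Definition local_coupling_condition (gammaH A : R) : Prop :=
  forall nu, in_N nu -> in_MV V nu -> Vnorm V nu <= A%:E * tvnorm nu ->
  tvnorm (S nu) <= gammaH%:E * tvnorm nu.

Definition geometric_decay (C g : R) : Prop :=
  forall nu, in_N nu -> in_MV V nu -> forall n,
  Vnorm V (iter n S nu) <= (C * g ^+ n)%:E * Vnorm V nu.

End ergodicity_conditions.

Section equilibrium.
Context d (T : measurableType d) (R : realType).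
Local Open Scope ereal_scope.
Variable V : T -> R.
Variable S : {charge set T -> \bar R} -> {charge set T -> \bar R}.
Hypotheses (mV : measurable_fun [set: T] V) (V1 : forall x, (1 <= V x)%R).
Hypothesis stochS : stochastic_op_V V S.
Implicit Types mu nu : {charge set T -> \bar R}.

Let V0 x : (0 <= V x)%R. Proof. exact: le_trans ler01 (V1 x). Qed.

Let stochastic_op_S : stochastic_op S. Proof. by case: stochS. Qed.

Let in_MV_S mu : in_MV V mu -> in_MV V (S mu).
Proof. by case: stochS => _ [+ _]; exact. Qed.

Lemma Vcvg_stochastic_op_V (mu : {charge set T -> \bar R}^nat) l :
  Vcvg V mu l -> Vcvg V (S \o mu) (S l).
Proof.
move=> mul; have [_ [_ [c S_bounded]]] := stochS.
have c_mul : c%:E * Vnorm V (csub (mu n) l) @[n --> \oo] --> 0.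
  by rewrite -(mule0 c%:E); exact: cvgeZl.
apply: squeeze_cvge (cvg_cst 0) c_mul.
have /fine_cvgP[finV _] := mul.
near=> n; rewrite Vnorm_ge0//=.
have -> : Vnorm V (csub (S (mu n)) (S l)) = Vnorm V (S (csub (mu n) l)).
  by apply: eq_Vnorm => // B mB; rewrite csubE stochastic_op_csub.
apply: S_bounded; rewrite /in_MV ltey_eq.
by apply/orP; left; near: n.
Unshelve. all: by end_near. Qed.

Lemma equilibrium_of_summable mu : is_prob mu -> in_MV V mu ->
  \sum_(0 <= k <oo) Vnorm V (csub (iter k.+1 S mu) (iter k S mu)) < +oo ->
  exists l, equilibrium S l /\ in_MV V l.
Proof.
move=> mu_prob muV /(Vnorm_complete mV V1)[l mul].
have prob_iter n : is_prob (iter n S mu).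
  by elim: n => // n; exact: stochastic_op_S.2.
have in_MV_iter n : in_MV V (iter n S mu) by elim: n => // n; exact: in_MV_S.
exists l; split; last exact: Vcvg_in_MV mul _.
split; first exact: is_prob_setwise_cvg (Vcvg_setwise_cvg mV V1 mul) _.
move=> B mB.
have S_mul := Vcvg_setwise_cvg mV V1 (Vcvg_stochastic_op_V mul) mB.
apply: (cvg_unique _ S_mul) => //.
by have := Vcvg_setwise_cvg mV V1 mul mB; rewrite -cvg_shiftS.
Qed.

Section geometric_decay.
Variables (C g : R).
Hypotheses (g01 : (0 < g < 1)%R) (decayS : geometric_decay V S C g).

Let decay_le nu n : in_N nu -> in_MV V nu ->
  Vnorm V (iter n S nu) <= (C * fine (Vnorm V nu) * g ^+ n)%:E.
Proof.
move=> nuN nuV; apply: le_trans (decayS nuN nuV n) _.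
by rewrite mulrAC [leRHS]EFinM fineK// ge0_fin_numE// Vnorm_ge0.
Qed.

Lemma equilibrium_unique mu nu : equilibrium S mu -> equilibrium S nu ->
  in_MV V mu -> in_MV V nu -> charge_eq mu nu.
Proof.
move=> [mu_prob Smu] [nu_prob Snu] muV nuV.
have fixed n : charge_eq (csub mu nu) (iter n S (csub mu nu)).
  elim: n => // n IH B mB /=.
  rewrite -(stochastic_op_eq stochastic_op_S IH)// stochastic_op_csub//.
  by rewrite Smu// Snu// csubE.
have munuN := in_N_csub_prob mu_prob nu_prob.
have munuV := in_MV_csub mV V0 muV nuV.
apply: (Vnorm_csub_le0 mV V1); apply: (cvge_to_ge (cvg_EFin_geometric _ g01)).
by apply: nearW => n; rewrite (eq_Vnorm mV V0 (fixed n)); exact: decay_le.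
Qed.

Lemma equilibrium_exists : exists mu, equilibrium S mu /\ in_MV V mu.
Proof.
pose mu : {charge set T -> \bar R} := cdirac R (point : T).
have mu_prob : is_prob mu by exact: is_prob_cdirac.
have muV : in_MV V mu by exact: in_MV_cdirac.
apply: (equilibrium_of_summable mu_prob muV).
have nuN := in_N_csub_prob (stochastic_op_S.2 _ mu_prob) mu_prob.
have nuV := in_MV_csub mV V0 (in_MV_S muV) muV.
apply: (nneseries_le_geometric_lty g01) => n; rewrite Vnorm_ge0//=.
have incr : charge_eq (csub (iter n.+1 S mu) (iter n S mu))
    (iter n S (csub (S mu) mu)).
  move=> B mB; rewrite csubE iterSr.
  by rewrite (stochastic_op_csub (stochastic_op_iter n stochastic_op_S)).
by rewrite (eq_Vnorm mV V0 incr); exact: decay_le.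
Qed.

End geometric_decay.
End equilibrium.

Section weighted_sum.
Context {R : realType}.

Lemma contraction_parameters (gammaH h K : R) :
  0 <= gammaH < 1 -> 0 <= h < 1 -> 0 <= K ->
  exists b g : R, [/\ 0 < b, 0 < g < 1, h <= g, gammaH + b * K <= g &
                  1 + b * h <= g * (1 + b)].
Proof.
move=> /andP[gammaH0 gammaH1] /andP[h0 h1] K0.
pose b := (1 - gammaH) / (2 * (K + 1)).
have b0 : 0 < b by rewrite divr_gt0//; lra.
have bK : b * (2 * (K + 1)) = 1 - gammaH by rewrite divfK//; apply/eqP; lra.
pose g := Num.max ((1 + gammaH) / 2) ((1 + b * h) / (1 + b)).
have g_ge_coupled : (1 + gammaH) / 2 <= g by rewrite le_max lexx.
have g_ge_uncoupled : (1 + b * h) / (1 + b) <= g by rewrite le_max lexx orbT.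
have bh_le : 1 + b * h <= g * (1 + b) by rewrite -ler_pdivrMr//; lra.
have g1 : g < 1.
  rewrite gt_max; apply/andP; split; first by lra.
  by rewrite ltr_pdivrMr; nra.
by exists b, g; split => //; [lra|nra|nra].
Qed.

(* [x] and [y] stand for [tvnorm nu] and [Vnorm V nu], [x'] and [y'] for the
   same norms of [S nu]. *)
Lemma weighted_sum_contraction (gammaL K gammaH A b g x y x' y' : R) :
  0 < A -> 0 <= K -> 0 < b -> g < 1 -> gammaL + K / A <= g ->
  gammaH + b * K <= g -> 1 + b * (gammaL + K / A) <= g * (1 + b) ->
  0 <= x <= y -> x' <= x -> y' <= gammaL * y + K * x ->
  (y <= A * x -> x' <= gammaH * x) -> x' + b * y' <= g * (x + b * y).
Proof.
move=> A0 K0 b0 g1 h_le_g gammaHbK_le bh_le /andP[x0 xy] x'x y'_le coupled.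
have KA0 : 0 <= K / A by rewrite divr_ge0// ltW.
have by'_le : b * y' <= b * (gammaL * y + K * x) by rewrite ler_pM2l.
have [/coupled x'_le|/ltW Axy] := leP y (A * x).
- have : (gammaH + b * K) * x <= g * x by rewrite ler_wpM2r.
  have : gammaL * (b * y) <= g * (b * y) by rewrite ler_wpM2r//; [nra|lra].
  lra.
- have Kx_le : K * x <= K / A * y.
    have <- : K / A * (A * x) = K * x by rewrite mulrA divfK// gt_eqF.
    by rewrite ler_wpM2l.
  have : b * (K * x) <= b * (K / A * y) by rewrite ler_pM2l.
  have : (1 - g) * x <= (1 - g) * y by rewrite ler_wpM2l//; lra.
  have : (1 + b * (gammaL + K / A)) * y <= g * (1 + b) * y.
    by rewrite ler_wpM2r//; lra.
  lra.
Qed.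

End weighted_sum.

Section lyapunov_coupling.
Context d (T : measurableType d) (R : realType).
Variable V : T -> R.
Variable S : {charge set T -> \bar R} -> {charge set T -> \bar R}.
Hypotheses (mV : measurable_fun [set: T] V) (V1 : forall x, 1 <= V x).
Hypothesis stochS : stochastic_op_V V S.
Implicit Types mu nu : {charge set T -> \bar R}.

Let V0 x : 0 <= V x. Proof. exact: le_trans ler01 (V1 x). Qed.

Let in_N_S nu : in_N nu -> in_N (S nu).
Proof. by case: stochS => stS _; rewrite /in_N stochastic_op_mass. Qed.

Let in_MV_S nu : in_MV V nu -> in_MV V (S nu).
Proof. by case: stochS => _ [+ _]; exact. Qed.

Lemma geometric_decay_of_contraction (W : T -> R) (a c g : R) :
  measurable_fun [set: T] W ->
  (forall x, V x <= a * W x) -> (forall x, 0 <= W x <= c * V x) ->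
  0 <= a -> 0 <= c -> 0 <= g ->
  (forall nu, in_N nu -> in_MV V nu ->
    (Vnorm W (S nu) <= g%:E * Vnorm W nu)%E) ->
  geometric_decay V S (a * c) g.
Proof.
move=> mW VW WV a0 c0 g0 contr nu nuN nuV n.
have W0 x : 0 <= W x by case/andP: (WV x).
have [_ _ Wn] : [/\ in_N (iter n S nu), in_MV V (iter n S nu) &
    (Vnorm W (iter n S nu) <= (g ^+ n)%:E * Vnorm W nu)%E].
  elim: n => [|n [nN nV IH]]; first by rewrite expr0 mul1e.
  split; [exact: in_N_S|exact: in_MV_S|].
  apply: le_trans (contr _ nN nV) _.
  by rewrite exprS EFinM -muleA lee_wpmul2l.
have VWn : (Vnorm V (iter n S nu) <= a%:E * Vnorm W (iter n S nu))%E.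
  by apply: le_Vnorm => // x; rewrite V0 VW.
apply: le_trans VWn _; rewrite -mulrA EFinM -muleA lee_wpmul2l//.
apply: le_trans Wn _; rewrite [c * _]mulrC EFinM -muleA.
rewrite lee_wpmul2l ?lee_fin ?exprn_ge0//.
exact: le_Vnorm.
Qed.

Lemma Vnorm_affine (b : R) nu : 0 <= b ->
  Vnorm (fun x => 1 + b * V x) nu = (tvnorm nu + b%:E * Vnorm V nu)%E.
Proof.
move=> b0; rewrite tvnormE /Vnorm -ge0_integralZl_EFin//; last 2 first.
  by move=> x _; rewrite lee_fin.
  exact/measurable_EFinP.
rewrite -ge0_integralD//.
- exact/measurable_EFinP.
- by move=> x _; rewrite -EFinM lee_fin mulr_ge0.
- by apply: measurable_funeM; exact/measurable_EFinP.
Qed.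

Lemma contraction_of_lyapunov_coupling (gammaL K gammaH A : R) :
  0 <= gammaL -> 0 <= K -> 0 <= gammaH < 1 -> 0 < A -> K / A < 1 - gammaL ->
  lyapunov_condition V S gammaL K -> local_coupling_condition V S gammaH A ->
  exists b g : R, [/\ 0 < b, 0 < g < 1 & forall nu, in_N nu -> in_MV V nu ->
    (Vnorm (fun x => 1 + b * V x)%R (S nu) <=
     g%:E * Vnorm (fun x => 1 + b * V x)%R nu)%E].
Proof.
move=> gammaL0 K0 gammaH01 A0 KA lyap coupling.
have KA0 : 0 <= K / A by rewrite divr_ge0// ltW.
have h01 : 0 <= gammaL + K / A < 1 by apply/andP; split; lra.
have [b [g [b0 g01 h_le_g gammaHbK_le bh_le]]] :=
  contraction_parameters gammaH01 h01 K0.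
have /andP[_ g1] := g01.
exists b, g; split=> // nu nuN nuV.
have fin_Vnorm mu : in_MV V mu -> Vnorm V mu \is a fin_num.
  by move=> muV; rewrite ge0_fin_numE// Vnorm_ge0.
rewrite !Vnorm_affine ?(ltW b0)//.
have := tvnorm_stochastic_op stochS.1 nu.
have := coupling _ nuN nuV; have := lyap _ nuV.
have := tvnorm_le_Vnorm mV V1 nu.
have := tvnorm_ge0 nu.
have /EFin_fin_numP[x ->] := tvnorm_fin_num nu.
have /EFin_fin_numP[x' ->] := tvnorm_fin_num (S nu).
have /EFin_fin_numP[y ->] := fin_Vnorm _ nuV.
have /EFin_fin_numP[y' ->] := fin_Vnorm _ (in_MV_S nuV).
rewrite -!EFinM -!EFinD !lee_fin => x0 xy y'_le coupled x'x.
apply: (weighted_sum_contraction A0 K0 b0 g1 h_le_g gammaHbK_le bh_le) => //.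
by rewrite x0.
Qed.

Lemma geometric_decay_of_lyapunov_coupling (gammaL K gammaH A : R) :
  0 <= gammaL -> 0 <= K -> 0 <= gammaH < 1 -> 0 < A -> K / A < 1 - gammaL ->
  lyapunov_condition V S gammaL K -> local_coupling_condition V S gammaH A ->
  exists C g : R, [/\ 1 <= C, 0 < g < 1 & geometric_decay V S C g].
Proof.
move=> gammaL0 K0 gammaH01 A0 KA lyap coupling.
have [b [g [b0 g01 contraction]]] :=
  contraction_of_lyapunov_coupling gammaL0 K0 gammaH01 A0 KA lyap coupling.
exists (b^-1 * (1 + b)), g; split=> //.
  by rewrite mulrDr mulVf ?gt_eqF// mulr1 lerDr invr_ge0 ltW.
have bV x : 0 <= b * V x by rewrite mulr_ge0// ltW.
apply: geometric_decay_of_contraction contraction.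
- by apply: measurable_funD => //; exact: measurable_funM.
- by move=> x; rewrite mulrDr mulKf ?gt_eqF// lerDr mulr1 invr_ge0 ltW.
- by move=> x; rewrite addr_ge0//= mulrDl mul1r lerD2r.
- by rewrite invr_ge0 ltW.
- by rewrite addr_ge0// ltW.
- by case/andP: g01 => /ltW.
Qed.

End lyapunov_coupling.

Theorem theorem3p2 (d : measure_display) (T : measurableType d) (R : realType)
  (V : T -> R)
  (S : {charge set T -> \bar R} -> {charge set T -> \bar R})
  (gammaL K gammaH A : R) :
  measurable_fun setT V ->
  (forall x, 1 <= V x) ->
  stochastic_op_V V S ->
  0 < gammaL < 1 -> 0 <= K ->
  (forall mu, in_MV V mu ->
     (Vnorm V (S mu) <= gammaL%:E * Vnorm V mu + K%:E * tvnorm mu)%E) ->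
  0 < gammaH < 1 -> 0 < A ->
  (forall nu, in_N nu -> in_MV V nu ->
     (Vnorm V nu <= A%:E * tvnorm nu)%E ->
     (tvnorm (S nu) <= gammaH%:E * tvnorm nu)%E) ->
  K / A < 1 - gammaL ->
  (exists mustar, equilibrium S mustar /\ in_MV V mustar /\
     (forall mu, equilibrium S mu -> in_MV V mu ->
        forall B, measurable B -> mu B = mustar B)) /\
  (exists gamma C : R, 0 < gamma < 1 /\ 1 <= C /\
     forall nu, in_N nu -> in_MV V nu -> forall n : nat,
       (Vnorm V (iter n S nu) <= (C * gamma ^+ n)%:E * Vnorm V nu)%E).
Proof.
move=> mV V1 stochS /andP[/ltW gammaL0 _] K0 lyapunov.
move=> /andP[/ltW gammaH0 gammaH1] A0 coupling KA.
have gammaH01 : 0 <= gammaH < 1 by rewrite gammaH0.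
have [C [gamma [C1 gamma01 decay]]] :=
  geometric_decay_of_lyapunov_coupling mV V1 stochS
    gammaL0 K0 gammaH01 A0 KA lyapunov coupling.
split; last by exists gamma, C.
have [mu [mu_eq muV]] := equilibrium_exists mV V1 stochS gamma01 decay.
exists mu; split=> //; split=> // nu nu_eq nuV.
exact: (equilibrium_unique mV V1 stochS gamma01 decay).
Qed.
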